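(* For any graph $G=(V,E)$ with weights $w: E \rightarrow \mathbb{N}$ and parameter $\varepsilon \in (0,1)$, the sample-and-solve algorithm described below outputs a matching of weight at least $(1-\varepsilon) \cdot \mu(G,w)$ with exponentially high probability.
   Context: Here $\mu(G,w)$ denotes the maximum matching weight in $G$ under edge weights $w$, $n=|V|$, and ''with exponentially high probability'' means with probability at least $1-\exp(-\Theta(n))$. A fractional odd-set cover is a pair $y \in \mathbb{R}^V$, $z \in \mathbb{R}^{odd(V)}$ (where $odd(V)$ is the collection of odd-cardinality vertex subsets) such that for every edge $e=(u,v)$, $y_u + y_v + \sum_{S \in odd(V),\, e \subseteq S} z_S \geq w(e)$; an edge $e$ is ''not covered'' by $(y,z)$ if this inequality fails for $e$. The algorithm: Input a general graph $G=(V,E)$ with weights $w: E\to\mathbb{N}$ and $\varepsilon\in(0,1)$. Start with importance $q^{(1)}_e = 1$ for every edge $e$, and let $Q^{(1)} := \sum_{e\in E} w(e)\, q^{(1)}_e$. Let $W := \sum_{e\in E} w(e)$. For $r = 1$ to $R := \frac{4}{\varepsilon}\log W$ iterations: (a) sample each edge $e \in E$ independently with probability $p^{(r)}_e := \frac{8n \ln(nW)}{\varepsilon} \cdot \frac{q^{(r)}_e \, w(e)}{Q^{(r)}}$; (b) compute a maximum weight matching $M^{(r)}$ and a minimum odd-set cover $(y^{(r)},z^{(r)})$ of the sampled graph (using the original weights $w$ on sampled edges); (c) for every edge $e\in E$ of the original graph not covered by $(y^{(r)},z^{(r)})$, set $q^{(r+1)}_e = 2 q^{(r)}_e$ (other edges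 keep their importance), and let $Q^{(r+1)} = \sum_{e\in E} w(e)\, q^{(r+1)}_e$. Finally, return the maximum weight matching among $M^{(1)},\dots,M^{(R)}$.
   Formalization: The minimum odd-set cover computed in each round is required to be nonnegative with laminar support (for arbitrary minimum covers the claim fails), and the number of rounds R, with log base 2 and rounded up, is at least one (for W = 1 the formula gives none). *)

(* Defs.v *)
From HB Require Import structures.
From mathcomp Require Import all_boot all_order all_algebra.
From mathcomp Require Import reals exp.

Set Implicit Arguments.
Unset Strict Implicit.
Unset Printing Implicit Defensive.

Import Order.TTheory GRing.Theory Num.Theory.
Local Open Scope ring_scope.

(* A graph on V is given by its edge set; an edge is a 2-element vertex set.
   Weights are total on {set V}, but only their values on edges are used. *)
Section Matchings.
Variable V : finType.
Implicit Types (E M : {set {set V}}) (w : {set V} -> nat).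

Definition simple_graph E : Prop := forall e, e \in E -> #|e| = 2.

Definition matching E M : bool := (M \subset E) && trivIset M.

Definition weight w M : nat := (\sum_(e in M) w e)%N.

Definition mu w E : nat := (\max_(M : {set {set V}} | matching E M) weight w M)%N.

Definition max_weight_matching w E M : Prop :=
  matching E M /\ forall M', matching E M' -> (weight w M' <= weight w M)%N.

End Matchings.

(* A pair (y, z); z is only ever used on sets of odd cardinality. *)
Record odd_sets_dual (R : realType) (V : finType) := OddSetsDual {
  dual_y : V -> R;
  dual_z : {set V} -> R
}.

Section OddSetCovers.
Variables (R : realType) (V : finType).
Implicit Types (E : {set {set V}}) (w : {set V} -> nat).
Implicit Types (d : odd_sets_dual R V).

Definition covered w d (e : {set V}) : bool :=
  (w e)%:R <= \sum_(v in e) dual_y d v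
              + \sum_(S : {set V} | odd #|S| && (e \subset S)) dual_z d S.

(* Nonnegativity is part of the dual of the matching linear program; without
   it the value below is in general unbounded from below. *)
Definition odd_set_cover w E d : Prop :=
  [/\ forall v, 0 <= dual_y d v,
      forall S : {set V}, odd #|S| -> 0 <= dual_z d S
    & forall e : {set V}, e \in E -> covered w d e].

Definition cover_value d : R :=
  \sum_v dual_y d v
  + \sum_(S : {set V} | odd #|S|) (#|S|%:R - 1) / 2 * dual_z d S.

Definition min_odd_set_cover w E d : Prop :=
  odd_set_cover w E d /\
  forall d', odd_set_cover w E d' -> cover_value d <= cover_value d'.

Definition laminar_dual d : Prop :=
  forall S T : {set V}, odd #|S| -> odd #|T| ->
    dual_z d S != 0 -> dual_z d T != 0 ->
    [|| S \subset T, T \subset S | [disjoint S & T]].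

End OddSetCovers.

(* A history lists the edge sets sampled so far, most recent first. A solver
   maps S :: h to the matching and the cover computed from the sample S; its
   choice among the optimal solutions may depend on the earlier samples h. *)
Definition history (V : finType) := seq {set {set V}}.

Record solver (R : realType) (V : finType) := Solver {
  solve_matching : history V -> {set {set V}};
  solve_cover : history V -> odd_sets_dual R V
}.

(* The cover is a minimum one with laminar support, as provided by the theorem
   of Cunningham and Marsh. Laminarity cannot be dropped: an adversarial choice
   among all minimum covers can keep every round away from the optimum. *)
Definition valid_solver (R : realType) (V : finType) (E : {set {set V}})
    (w : {set V} -> nat) (A : solver R V) : Prop :=
  forall (S : {set {set V}}) (h : history V), S \subset E ->
    [/\ max_weight_matching w S (solve_matching A (S :: h)),
        min_odd_set_cover w S (solve_cover A (S :: h))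
      & laminar_dual (solve_cover A (S :: h))].

Section SampleAndSolve.
Variables (R : realType) (V : finType) (E : {set {set V}}).
Variables (w : {set V} -> nat) (eps : R) (A : solver R V).
Implicit Types (h : history V) (S : {set {set V}}).

Definition total_weight : nat := (\sum_(e in E) w e)%N.

(* (4 / eps) log_2 W, rounded up, and at least one round (this only matters for
   W <= 1, where log_2 W gives none and there would be no matching to return);
   ln 0 = 0 in the library. *)
Definition rounds : nat :=
  maxn 1 `|Num.ceil (4 / eps * (ln total_weight%:R / ln 2))|%N.

(* importance h e is q_e^(r) for r = size h + 1 *)
Fixpoint importance h (e : {set V}) : R :=
  if h is _ :: h' then
    if covered w (solve_cover A h) e then importance h' e
    else 2 * importance h' e
  else 1.

Definition total_importance h : R := \sum_(e in E) (w e)%:R * importance h e.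

(* Sampling with a "probability" above 1 means sampling with certainty. *)
Definition edge_prob h (e : {set V}) : R :=
  Num.min 1
    (8 * #|V|%:R * ln (#|V|%:R * total_weight%:R) / eps
     * (importance h e * (w e)%:R / total_importance h)).

(* probability that, after history h, the next sampled edge set is exactly S *)
Definition sample_prob h S : R :=
  if S \subset E then
    \prod_(e in E) (if e \in S then edge_prob h e else 1 - edge_prob h e)
  else 0.

Fixpoint history_prob h : R :=
  if h is F :: h' then sample_prob h' F * history_prob h' else 1.

Fixpoint output h : {set {set V}} :=
  if h is _ :: h' then
    let M := solve_matching A h in
    let M' := output h' in
    if (weight w M' <= weight w M)%N then M else M'
  else set0.

Definition output_prob (P : pred {set {set V}}) : R :=
  \sum_(h : rounds.-tuple {set {set V}} | P (output h)) history_prob h.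

End SampleAndSolve.

(* Main.v *)
Require Import Defs.
From mathcomp Require Import all_boot all_order all_algebra.
From mathcomp Require Import boolp reals sequences exp.
From mathcomp Require Import zify ring lra.
Set Implicit Arguments.
Unset Strict Implicit.
Unset Printing Implicit Defensive.
Import Order.TTheory GRing.Theory Num.Theory.
Local Open Scope ring_scope.

(* Call a round bad if the uncovered edges carry more than an eps/2 fraction of
   the total importance Q. If no round is bad, Q grows by a factor at most
   1 + eps/2 per round. If moreover every round returned a matching of weight
   below (1 - eps) mu, LP duality for matchings would leave weight at least
   eps mu of a fixed optimal matching uncovered in each round, and by convexity
   of 2^x the importance would reach mu 2^(eps r) after r rounds; for
   r >= (4 / eps) log_2 W the two bounds are incompatible.

   A fixed heavy set of edges avoids the sample with probability at most
   (n W)^(-4n), so it remains to count the sets of edges that a laminar cover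
   can leave uncovered. For laminar z >= 0 the quantity
   Z(u, v) = sum of the z_S over the odd S containing u and v satisfies
   Z(u, v) >= min(Z(u, x), Z(x, v)), hence is the bottleneck value of a tree
   x -> p x with n real edge labels. The uncovered set is thus determined by p
   and by the signs of at most W n affine forms in 2n variables, and the
   Sauer-Shelah lemma bounds the number of sign vectors by (W n + 1)^(2n).

   The union bound over the rounds loses a factor of at most W: if eps is so
   small that there are more rounds, the first round samples every edge of
   positive weight. *)

(** * Shattering and the Sauer-Shelah bound *)

Section SauerShelah.
Variable T : finType.
Implicit Types (F G : {set {set T}}) (X Y A : {set T}).

Definition shatters F X : bool :=
  [forall Y in powerset X, [exists A in F, X :&: A == Y]].

Lemma shattersP F X :
  reflect (forall Y, Y \subset X -> exists2 A, A \in F & X :&: A = Y)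
          (shatters F X).
Proof.
apply: (iffP forall_inP) => sh Y.
  rewrite -powersetE => /sh /exists_inP[A AF /eqP XA].
  by exists A.
by rewrite inE => /sh[A AF XA]; apply/exists_inP; exists A => //; apply/eqP.
Qed.

Lemma shattersS F G X : F \subset G -> shatters F X -> shatters G X.
Proof.
move=> /subsetP sFG /shattersP sh; apply/shattersP => Y /sh[A AF XA].
by exists A; first exact: sFG.
Qed.

Definition shattered F : {set {set T}} := [set X | shatters F X].

(* Pajor's strengthening of the Sauer-Shelah lemma. *)
Lemma card_le_shattered F : (#|F| <= #|shattered F|)%N.
Proof.
have [n] := ubnP #|F|; elim: n F => // n IHn F; rewrite ltnS => leFn.
have [F1|/card_gt1P[A [B [AF BF neqAB]]]] := leqP #|F| 1%N.
  have [->|/set0Pn[A AF]] := eqVneq F set0; first by rewrite cards0.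
  apply: leq_trans F1 _; apply/card_gt0P; exists set0.
  rewrite inE; apply/shattersP => Y; rewrite subset0 => /eqP->.
  by exists A; rewrite // set0I.
have [x xAB] : exists x, (x \in A) != (x \in B).
  apply/existsP; apply: contraNT neqAB; rewrite negb_exists => /forallP eqAB.
  by apply/eqP/setP => x; apply/eqP; have := eqAB x; rewrite negbK.
pose F1 := [set C in F | x \in C]; pose F0 := [set C in F | x \notin C].
have splitF : (#|F| = #|F1| + #|F0|)%N.
  rewrite -(cardsID [set C : {set T} | x \in C] F); congr (_ + _)%N; apply: eq_card => C.
    by rewrite !inE.
  by rewrite !inE andbC.
have F1gt0 : (0 < #|F1|)%N.
  apply/card_gt0P; case xA: (x \in A) xAB => xAB; first by exists A; rewrite inE AF.
  by exists B; rewrite inE BF /=; case: (x \in B) xAB.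
have F0gt0 : (0 < #|F0|)%N.
  apply/card_gt0P; case xA: (x \in A) xAB => xAB; last by exists A; rewrite inE AF xA.
  by exists B; rewrite inE BF /=; case: (x \in B) xAB.
have IH1 : (#|F1| <= #|shattered F1|)%N by apply: IHn; lia.
have IH0 : (#|F0| <= #|shattered F0|)%N by apply: IHn; lia.
have xN1 X : X \in shattered F1 -> x \notin X.
  rewrite inE => /shattersP sh; apply/negP => xX.
  have [|C] := sh set0; first exact: sub0set.
  by rewrite inE => /andP[_ xC] /setP/(_ x); rewrite !inE xX xC.
have xN0 X : X \in shattered F0 -> x \notin X.
  rewrite inE => /shattersP sh; apply/negP => xX.
  have [|C] := sh X; first exact: subxx.
  by rewrite inE => /andP[_ xC] /setP/(_ x); rewrite !inE xX (negPf xC).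
(* A set shattered by both halves counts twice: [F] shatters it with and without [x]. No set
   shattered by a half contains [x], so [U] and [J] are disjoint and together have as many elements
   as the two shattered families. *)
set U := shattered F1 :|: shattered F0; set I := shattered F1 :&: shattered F0.
pose J := [set x |: X | X in I].
have cardJ : #|J| = #|I|.
  apply: card_in_imset => X Y /setIP[/xN1 xX _] /setIP[/xN1 xY _] eqXY.
  by rewrite -(setU1K xX) eqXY setU1K.
have disUJ : [disjoint U & J].
  rewrite -setI_eq0; apply/eqP/setP => X; rewrite !inE.
  apply/negbTE/negP => /andP[XU /imsetP[Y _ eqX]].
  have xX : x \in X by rewrite eqX setU11.
  by case/orP: XU => XU; [have := @xN1 X | have := @xN0 X]; rewrite inE xX => /(_ XU).
have sUJ : U :|: J \subset shattered F.
  apply/subsetP => X /setUP[/setUP[]|/imsetP[Y /setIP[Y1 Y0] ->]].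
  - by rewrite !inE; apply: shattersS; apply/subsetP => C; rewrite inE => /andP[].
  - by rewrite !inE; apply: shattersS; apply/subsetP => C; rewrite inE => /andP[].
  have xY := xN1 _ Y1; move: Y1 Y0; rewrite !inE => /shattersP sh1 /shattersP sh0.
  apply/shattersP => Z sZ.
  have sZY : Z :\ x \subset Y by rewrite subDset.
  have [xZ|xZ] := boolP (x \in Z).
    have [C] := sh1 _ sZY; rewrite inE => /andP[CF xC] YC; exists C => //.
    by rewrite setIUl YC (setIidPl _) ?sub1set // setD1K.
  have [C] := sh0 _ sZY; rewrite inE => /andP[CF xC] YC; exists C => //.
  rewrite setIUl YC (_ : [set x] :&: C = set0) ?set0U; last first.
    by apply/eqP; rewrite setI_eq0 disjoints1.
  by apply/setP => y; rewrite !inE; case: eqP => // ->; rewrite (negPf xZ).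
apply: leq_trans (subset_leq_card sUJ).
rewrite cardsU (disjoint_setI0 disUJ) cards0 subn0 cardJ cardsUI splitF.
exact: leq_add.
Qed.

(** Maps from ['I_k] to [option T] parametrize these sets, with [None] as padding. *)
Lemma card_small_sets k : (#|[set X : {set T} | (#|X| <= k)%N]| <= #|T|.+1 ^ k)%N.
Proof.
pose f (g : {ffun 'I_k -> option T}) : {set T} := [set x | [exists i, g i == Some x]].
rewrite -card_option -[X in (_ ^ X)%N](card_ord k) -card_ffun.
apply: leq_trans (leq_imset_card f _); apply: subset_leq_card.
apply/subsetP => X; rewrite inE => leXk; apply/imsetP.
pose s := map Some (enum X).
exists [ffun i : 'I_k => nth None s i] => //.
apply/setP => x; rewrite inE; apply/idP/existsP => [xX|[i]].
  have lt_i : (index x (enum X) < k)%N.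
    by apply: leq_trans leXk; rewrite cardE index_mem mem_enum.
  exists (Ordinal lt_i); rewrite ffunE (nth_map x) /= ?index_mem ?mem_enum //.
  by rewrite nth_index ?mem_enum.
rewrite ffunE => /eqP Hi; have := @mem_nth _ None s i; rewrite Hi.
have [lt_i /(_ isT)|ge_i] := ltnP i (size s); last by rewrite nth_default in Hi.
by move/mapP => [y]; rewrite mem_enum => yX [->].
Qed.

Lemma card_family_le F k :
  (forall X, shatters F X -> (#|X| <= k)%N) -> (#|F| <= #|T|.+1 ^ k)%N.
Proof.
move=> vc; apply: leq_trans (card_le_shattered F) _.
apply: leq_trans (card_small_sets k); apply: subset_leq_card.
by apply/subsetP => X; rewrite !inE => /vc.
Qed.

End SauerShelah.

(** * Counting sign vectors of affine forms *)

Section SignPatterns.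
Variables (R : realFieldType) (T : finType) (k : nat).
Variables (a : T -> 'rV[R]_k) (b : T -> R).

Definition below (x : 'cV[R]_k) : {set T} := [set i | (a i *m x) 0 0 < b i].

(* A linear dependency between the rows a i, i in X, makes a combination of
   the affine forms constant; two opposite sign vectors would give it two
   different signs. *)
Lemma shatters_below_card (F : {set {set T}}) (X : {set T}) :
  (forall A, A \in F -> exists x, A = below x) -> shatters F X -> (#|X| <= k)%N.
Proof.
move=> Fbelow /shattersP sh; rewrite leqNgt; apply/negP => ltkX.
pose M : 'M[R]_(#|X|, k) := \matrix_(i < #|X|) a (enum_val i).
have /rowV0Pn[c /sub_kermxP cM c0] : kermx M != 0.
  by rewrite kermx_eq0 -row_leq_rank -ltnNge (leq_ltn_trans (rank_leq_col M)).
pose g (i : 'I_#|X|) (x : 'cV[R]_k) : R := (a (enum_val i) *m x) 0 0.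
have cg x : \sum_i c 0 i * g i x = 0.
  have : (c *m M *m x) 0 0 = 0 by rewrite cM mul0mx mxE.
  rewrite -mulmxA mxE => cMx; rewrite -[RHS]cMx.
  apply: eq_bigr => i _; congr (_ * _).
  by rewrite /g -(rowK (fun i => a (enum_val i)) i) -row_mul mxE.
have sep (s : R) : exists x, forall i,
    (g i x < b (enum_val i)) = (0 < s * c 0 i).
  pose Y := [set t in X | [exists i, (enum_val i == t) && (0 < s * c 0 i)]].
  have [|A /Fbelow[x ->] XA] := sh Y.
    by apply/subsetP => t; rewrite inE => /andP[].
  exists x => i; move/setP/(_ (enum_val i)): XA; rewrite !inE enum_valP /= => ->.
  apply/existsP/idP => [[j /andP[/eqP/enum_val_inj-> //]]|ci].
  by exists i; rewrite eqxx.
have [j cj] : exists j, c 0 j != 0.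
  apply/existsP; apply: contraNT c0; rewrite negb_exists => /forallP c0.
  by apply/eqP/rowP => j; rewrite !mxE; apply/eqP; have := c0 j; rewrite negbK.
pose K := \sum_i c 0 i * b (enum_val i).
(* The forms [g i x] cancel against [c], so the nonnegative terms add up to [s * K] whatever [x] is.
   Taking [s = 1] and [s = -1] forces [K = 0], although one of them makes the term at [j]
   positive. *)
have key (s : R) : s != 0 -> (0 <= s * K) && ((0 < s * c 0 j) ==> (0 < s * K)).
  move=> s0; have [x Hx] := sep s.
  have termge i : 0 <= s * c 0 i * (b (enum_val i) - g i x).
    have := Hx i; case: (ltP 0 (s * c 0 i)) => [sc gb|sc].
      by rewrite mulr_ge0 ?subr_ge0 // ltW.
    by move/negbT; rewrite -leNgt => gb; rewrite mulr_le0 ?subr_le0.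
  have -> : s * K = \sum_i s * c 0 i * (b (enum_val i) - g i x).
    transitivity (s * (K - \sum_i c 0 i * g i x)); first by rewrite cg subr0.
    rewrite /K -sumrB mulr_sumr; apply: eq_bigr => i _.
    by rewrite -mulrBr mulrA.
  rewrite sumr_ge0 //=; apply/implyP => scj.
  rewrite (bigD1 j) //= ltr_pwDl ?sumr_ge0 //.
  by have := Hx j; rewrite scj => gb; rewrite mulr_gt0 // subr_gt0.
have /andP[Kp Kp'] := key 1 (oner_neq0 _).
have /andP[Kn Kn'] : (0 <= (-1) * K) && ((0 < (-1) * c 0 j) ==> (0 < (-1) * K)).
  by apply: key; rewrite oppr_eq0 oner_neq0.
move: Kp Kp' Kn Kn'; rewrite !mul1r !mulN1r oppr_ge0 => Kp Kp' Kn Kn'.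
have K0 : K = 0 by apply/le_anti; rewrite Kp Kn.
move: Kp' Kn'; rewrite K0 oppr0 ltxx !implybF oppr_gt0 -!leNgt => c1 c2.
by move: cj; rewrite eq_le c1 c2.
Qed.

Lemma card_sign_patterns (F : {set {set T}}) :
  (forall A, A \in F -> exists x, A = below x) -> (#|F| <= #|T|.+1 ^ k)%N.
Proof. by move=> Fb; apply: card_family_le => X; exact: shatters_below_card. Qed.

End SignPatterns.

(** * Tree representation of an ultrametric similarity *)

Section Ultrametric.
Variables (R : realDomainType) (V : finType) (Z : V -> V -> R).
Implicit Types (p : V -> V) (s : seq V).

(** Read from the end of [s], a tree grows by attaching each new [x] to a most similar vertex [p x]
    already present; the last entry is the root, where [p] is unconstrained. *)
Fixpoint greedy p s : Prop :=
  if s is x :: s' then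
    (s' != [::] -> p x \in s' /\ forall v, v \in s' -> Z x v <= Z x (p x))
    /\ greedy p s'
  else True.

Lemma eq_in_greedy p q s : {in s, p =1 q} -> greedy p s -> greedy q s.
Proof.
elim: s => //= x s IHs eq_pq [px ps]; rewrite -eq_pq ?mem_head //; split=> //.
by apply: IHs => // y ys; apply: eq_pq; rewrite inE ys orbT.
Qed.

Lemma exists_greedy s : uniq s -> exists p, greedy p s.
Proof.
elim: s => [|x s IHs] /=; first by exists id.
case/andP=> xs /IHs[p ps]; case: s xs ps {IHs} => [|y s]; first by exists id.
set s' := y :: s => xs ps.
have [u us umax] : exists2 u, u \in s' & forall v, v \in s' -> Z x v <= Z x u.
  by case: (@arg_maxP _ _ V y (mem s') (Z x)) => [|u us umax]; [exact: mem_head | exists u].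
exists (fun z => if z == x then u else p z); rewrite eqxx; split=> //.
apply: eq_in_greedy ps => z zs; case: eqP => // zx.
by rewrite -zx zs in xs.
Qed.

(** The path is recorded by the child ends of its edges. Of [u] and [v], the one met first in [s]
    was attached later, so its parent edge lies on the path. *)
Fixpoint tree_path p s u v : seq V :=
  if s is x :: s' then
    if u == v then [::]
    else if x == u then x :: tree_path p s' (p x) v
    else if x == v then x :: tree_path p s' (p x) u
    else tree_path p s' u v
  else [::].

Lemma tree_pathxx p s u : tree_path p s u u = [::].
Proof. by case: s => //= x s; rewrite eqxx. Qed.

Hypothesis Zsym : forall u v, Z u v = Z v u.
Hypothesis Zultra : forall u x v, Z u x <= Z u v \/ Z x v <= Z u v.

(** In a triangle the two smallest similarities coincide, so [Z x v] is the minimum of [Z x q] and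
    [Z q v]. The form with a threshold [t] composes along paths. *)
Lemma ultra_nearest x q v : Z x v <= Z x q ->
  forall t, (t <= Z x v) = (t <= Z x q) && (t <= Z q v).
Proof.
move=> xq t; apply/idP/andP => [txv|[txq tqv]]; last first.
  by case: (Zultra x q v) => [/(le_trans txq)|/(le_trans tqv)].
split; first exact: le_trans xq.
case: (Zultra q x v); first by apply: le_trans; rewrite Zsym (le_trans txv).
exact: le_trans.
Qed.

(* Z is the bottleneck similarity of the tree linking each vertex x to p x. *)
Lemma le_tree_path p s u v t : greedy p s -> u \in s -> v \in s -> u != v ->
  (t <= Z u v) = all (fun x => t <= Z x (p x)) (tree_path p s u v).
Proof.
elim: s u v => //= x s IHs u v [px ps].
have step z : x != z -> z \in x :: s ->
    (t <= Z x z) = (t <= Z x (p x)) &&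
                   all (fun x => t <= Z x (p x)) (tree_path p s (p x) z).
  rewrite inE eq_sym => /negPf-> /= zs.
  have [|pxs /(_ z zs) pmax] := px; first by case: (s) zs.
  rewrite (ultra_nearest pmax); have [<-|pz] := eqVneq (p x) z.
    (* The path from [z] to itself is empty; the leftover condition [t <= Z z z] holds because
       [Zultra] and symmetry give [Z x z <= Z z z]. *)
    by rewrite tree_pathxx /= andbT; apply: andb_idr => /le_trans; apply;
       case: (Zultra (p x) x (p x)) => //; rewrite Zsym.
  by rewrite (IHs (p x) z).
rewrite !inE => us vs uv; rewrite (negPf uv).
case: (eqVneq x u) us => [xu _|xu us].
  by subst u; rewrite step // inE.
case: (eqVneq x v) vs => [xv _|xv vs].
  by subst v; rewrite Zsym step // inE; apply/orP; right.
exact: IHs.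
Qed.

End Ultrametric.

(** * Counting the possible sets of uncovered edges *)

Section UncoveredSets.
Variables (R : realType) (V : finType) (E : {set {set V}}) (w : {set V} -> nat).
Implicit Types (d : odd_sets_dual R V) (u v x : V) (e : {set V}).

Definition odd_link d u v : R :=
  \sum_(S : {set V} | odd #|S| && ([set u; v] \subset S)) dual_z d S.

Lemma odd_linkC d u v : odd_link d u v = odd_link d v u.
Proof. by rewrite /odd_link setUC. Qed.

(* The sets of the support that contain x form a chain, so those containing u
   and x are comparable with those containing x and v. *)
Lemma odd_link_ultra d u x v :
  (forall S : {set V}, odd #|S| -> 0 <= dual_z d S) -> laminar_dual d ->
  odd_link d u x <= odd_link d u v \/ odd_link d x v <= odd_link d u v.
Proof.
move=> z0 lam.
have sub2 a b (S : {set V}) : ([set a; b] \subset S) = (a \in S) && (b \in S).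
  by rewrite subUset !sub1set.
have mono (P Q : pred {set V}) :
    (forall S : {set V}, odd #|S| -> dual_z d S != 0 -> P S -> Q S) ->
    \sum_(S : {set V} | odd #|S| && P S) dual_z d S <=
    \sum_(S : {set V} | odd #|S| && Q S) dual_z d S.
  move=> PQ; rewrite (bigID (fun S => dual_z d S == 0)) /= big1 ?add0r; last first.
    by move=> S /andP[_ /eqP].
  rewrite [leRHS](bigID (fun S => (P S) && (dual_z d S != 0))) /=.
  rewrite -[leLHS]addr0 lerD ?sumr_ge0 //; last by move=> S /andP[/andP[/z0]].
  rewrite le_eqVlt; apply/orP; left; apply/eqP/eq_bigl => S.
  apply/idP/idP => [/andP[/andP[oS PS] S0]|/andP[/andP[-> _] /andP[-> ->]] //].
  by rewrite oS PS S0 PQ.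
(* If a support set [S] has [u] and [x] but not [v], then a support set [T] with [x] and [v] meets
   [S] and is not inside it, so it contains [S] and hence [u]. Otherwise every support set with [u]
   and [x] contains [v]. *)
case: (boolP [exists S : {set V},
  [&& odd #|S|, dual_z d S != 0, u \in S, x \in S & v \notin S]]).
  case/existsP=> S /and5P[oS S0 uS xS vS]; right; apply: mono => T oT T0.
  rewrite !sub2 => /andP[xT vT]; rewrite vT andbT.
  have /or3P[/subsetP->//|/subsetP/(_ v vT)|] := lam S T oS oT S0 T0.
    by rewrite (negPf vS).
  by rewrite -setI_eq0 => /eqP/setP/(_ x); rewrite !inE xS xT.
rewrite negb_exists => /forallP noS; left; apply: mono => S oS S0.
rewrite !sub2 => /andP[uS xS]; rewrite uS /=.
by have := noS S; rewrite oS S0 uS xS /= negbK.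
Qed.

Let n := #|V|.
Definition positive_edges := [set e in E | (0 < w e)%N].
Local Notation D := ({e : {set V} | e \in positive_edges} * V)%type.

(** A pair of an edge [e] and a vertex [x] stands for the form [y(e) + t x], to be compared with
    [w e]; [t x] is the label of the tree edge from [x] to [p x]. The values of [y] and the labels
    account for the dimension [n + n]. *)
Definition edge_row (i : D) : 'rV[R]_(n + n) :=
  row_mx (\row_j (enum_val j \in val i.1)%:R) (\row_j (enum_val j == i.2)%:R).

Definition dual_col (y t : V -> R) : 'cV[R]_(n + n) :=
  col_mx (\col_j y (enum_val j)) (\col_j t (enum_val j)).

Lemma edge_row_dual i y t :
  (edge_row i *m dual_col y t) 0 0 = \sum_(v in val i.1) y v + t i.2.
Proof.
rewrite mul_row_col !mxE; congr (_ + _).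
  rewrite [RHS]big_mkcond (reindex (@enum_val V predT)) /=; last first.
    by apply: onW_bij; exact: enum_val_bij.
  apply: eq_bigr => j _; rewrite !mxE.
  by case: ifP; rewrite ?mul1r ?mul0r.
rewrite (bigD1 (enum_rank i.2)) //= !mxE enum_rankK eqxx mul1r big1 ?addr0 //.
move=> j; rewrite !mxE => ji; rewrite (_ : _ == _ = false) ?mul0r //.
by apply/negbTE; apply: contraNneq ji => <-; rewrite enum_valK.
Qed.

Definition sign_family : {set {set D}} :=
  [set A | `[< exists c, A = below edge_row (fun i => (w (val i.1))%:R) c >]].

(** The edge [e] joining [u] and [v] is uncovered iff [Z u v < w e - y(e)], that is, iff some [x] on
    the tree path has [y(e) + t x < w e]. So the tree and the sign vector determine the uncovered
    set. *)
Definition decode (p : {ffun V -> V}) (A : {set D}) : {set {set V}} :=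
  [set e in positive_edges |
    [exists u, [exists v, [&& u != v, e == [set u; v] &
      has (fun x => if insub e is Some e' then (e', x) \in A else false)
          (tree_path p (enum V) u v)]]]].

Definition uncovered_family : {set {set {set V}}} :=
  [set decode pA.1 pA.2 | pA in setX setT sign_family].

Lemma card_uncovered_family :
  (#|uncovered_family| <= n ^ n * (#|positive_edges| * n).+1 ^ (n + n))%N.
Proof.
apply: leq_trans (leq_imset_card _ _) _; rewrite cardsX.
apply: leq_mul; first by rewrite cardsT card_ffun.
apply: leq_trans (card_sign_patterns (a := edge_row)
                    (b := fun i => (w (val i.1))%:R) _) _.
  by move=> A; rewrite inE => /asboolP.
by rewrite card_prod card_sig.
Qed.

Definition uncovered d : {set {set V}} := [set e in E | ~~ covered w d e].

Lemma uncovered_in_family d : simple_graph E ->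
  (forall v, 0 <= dual_y d v) ->
  (forall S : {set V}, odd #|S| -> 0 <= dual_z d S) -> laminar_dual d ->
  uncovered d \in uncovered_family.
Proof.
move=> simpleE y0 z0 lam.
pose Z := odd_link d.
have Zsym u v : Z u v = Z v u by exact: odd_linkC.
have Zultra u x v : Z u x <= Z u v \/ Z x v <= Z u v by exact: odd_link_ultra.
have [p gp] := exists_greedy Z (enum_uniq V).
pose t v := Z v (p v).
pose A := below edge_row (fun i => (w (val i.1))%:R) (dual_col (dual_y d) t).
apply/imsetP; exists ([ffun v => p v], A).
  by rewrite inE /= inE inE; apply/asboolP; exists (dual_col (dual_y d) t).
apply/setP => e; rewrite !inE.
have [eE|] //= := boolP (e \in E).
(* Nonnegative duals cover every edge of weight 0, so [positive_edges] misses no uncovered edge. *)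
have [w0|w0] := posnP (w e).
  by rewrite /covered w0 addr_ge0 ?sumr_ge0 // => S /andP[/z0].
have ep : e \in positive_edges by rewrite inE eE.
have unc u v : u != v -> e = [set u; v] -> ~~ covered w d e =
   has (fun x => if insub e is Some e' then (e', x) \in A else false)
       (tree_path [ffun v => p v] (enum V) u v).
  move=> uv euv.
  have -> : tree_path [ffun v => p v] (enum V) u v = tree_path p (enum V) u v.
    elim: (enum V) (u) (v) => //= x s IHs a b.
    by rewrite !ffunE !IHs.
  have -> : covered w d e = ((w e)%:R - \sum_(v in e) dual_y d v <= Z u v).
    by rewrite lerBlDl /Z /odd_link -euv.
  rewrite (le_tree_path Zsym Zultra _ gp) ?mem_enum // -has_predC.
  apply: eq_has => x /=; rewrite insubT inE edge_row_dual /=.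
  by rewrite -ltNge ltrBrDl.
have /eqP/cards2P[u [v [uv euv]]] := simpleE e eE.
rewrite /= (unc u v) //; apply/idP/existsP => [h|[u' /existsP[v' /and3P[uv' /eqP euv' h]]]].
  by exists u; apply/existsP; exists v; rewrite uv euv eqxx -euv.
by rewrite -(unc u v) // (unc u' v').
Qed.

End UncoveredSets.

(** * Matchings and exchanges inside a vertex set *)

Section MatchingFacts.
Variable V : finType.
Implicit Types (E F M N P : {set {set V}}) (w : {set V} -> nat) (X : {set V}).

Lemma matching0 E : matching E set0.
Proof.
by rewrite /matching sub0set; apply/trivIsetP => A B; rewrite inE.
Qed.

Lemma weight_le_mu w E M : matching E M -> (weight w M <= mu w E)%N.
Proof. exact: (leq_bigmax_cond (F := weight w)). Qed.

Lemma mu_attained w E : exists2 M, matching E M & weight w M = mu w E.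
Proof.
have [|M mM eqM] := @eq_bigmax_cond _ (matching E) (weight w).
  by apply/card_gt0P; exists set0; exact: matching0.
by exists M.
Qed.

Lemma matchingS E F M : E \subset F -> matching E M -> matching F M.
Proof. by move=> sEF /andP[sME tM]; rewrite /matching (subset_trans sME). Qed.

Lemma matchingI E F M : matching E M -> matching (E :&: F) (M :&: F).
Proof.
move=> /andP[sME tM]; rewrite /matching setSI //=.
by apply: trivIsetS tM; rewrite subsetIl.
Qed.

Lemma weightI w E F M : M \subset E ->
  (forall e, e \in E -> e \notin F -> w e = 0%N) -> weight w (M :&: F) = weight w M.
Proof.
move=> sME w0; rewrite /weight [RHS](big_setID F) /= [X in (_ + X)%N]big1 ?addn0 //.
by move=> e /setDP[/(subsetP sME) eE]; exact: w0.
Qed.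

Lemma mu_support w E F : F \subset E ->
  (forall e, e \in E -> e \notin F -> w e = 0%N) -> mu w F = mu w E.
Proof.
move=> sFE w0; apply/eqP; rewrite eqn_leq; apply/andP; split.
  by have [M /(matchingS sFE) mM <-] := mu_attained w F; exact: weight_le_mu.
have [M mM <-] := mu_attained w E; have /andP[sME _] := mM.
rewrite -(weightI sME w0); apply: weight_le_mu.
by have := matchingI F mM; rewrite (setIidPr sFE).
Qed.

Lemma card_cover2 M : trivIset M -> (forall e, e \in M -> #|e| = 2) ->
  #|cover M| = (2 * #|M|)%N.
Proof.
move=> /eqP <- M2; rewrite (eq_bigr (fun=> 2)) //.
by rewrite sum_nat_const mulnC.
Qed.

Lemma weight_card M : weight (fun=> 1%N) M = #|M|.
Proof. exact: sum1_card. Qed.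

Definition swap X M N := (M :\: (M ::&: X)) :|: (N ::&: X).

Definition separated X M := forall e, e \in M -> (e \subset X) || [disjoint e & X].

(** The additive form avoids truncated subtraction; the constant weight 1 turns it into an edge
    count. *)
Lemma weight_swap w X M N :
  (weight w (swap X M N) + weight w (M ::&: X) = weight w M + weight w (N ::&: X))%N.
Proof.
have sMX : M ::&: X \subset M by apply/subsetP => e; rewrite inE => /andP[].
have swapI : swap X M N :&: (N ::&: X) = N ::&: X.
  by apply/setIidPr; rewrite subsetUr.
have swapD : swap X M N :\: (N ::&: X) = M :\: (M ::&: X).
  apply/setP => e; rewrite !inE.
  by case: (e \in M); case: (e \in N); case: (e \subset X).
rewrite /weight (big_setID (N ::&: X)) /= swapI swapD.
by rewrite [in RHS](big_setID (M ::&: X)) /= (setIidPr sMX); lia.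
Qed.

Lemma matching_swap P X M N : matching P M -> matching P N ->
  separated X M -> separated X N -> matching P (swap X M N).
Proof.
move=> /andP[sM tM] /andP[sN tN] sepM sepN; apply/andP; split.
  by rewrite subUset (subset_trans (subsetDl _ _) sM) (subset_trans _ sN) // ;
     apply/subsetP => e; rewrite inE => /andP[].
apply/trivIsetP => A B; rewrite !inE.
have sep (A' B' : {set V}) : A' \in M -> ~~ (A' \subset X) -> B' \subset X -> [disjoint A' & B'].
  move=> A'M A'X B'X; have := sepM A' A'M; rewrite (negPf A'X) /=.
  exact: (disjointWr B'X).
case/orP=> /andP[AM AX]; case/orP=> /andP[BM BX] neq.
- by apply: (trivIsetP tM).
- by apply: sep => //; move: AM; rewrite AX.
- by rewrite disjoint_sym; apply: sep => //; move: BM; rewrite BX.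
- by apply: (trivIsetP tN).
Qed.

Lemma swap_misses X M N x : x \notin cover N -> x \in X -> separated X M ->
  x \notin cover (swap X M N).
Proof.
move=> xN xX sepM; apply/bigcupP => -[e]; rewrite !inE.
case/orP=> /andP[].
  move=> eX eM xe; move: eX; rewrite eM /= => eX.
  have := sepM e eM; rewrite (negPf eX) /= -setI_eq0 => /eqP/setP/(_ x).
  by rewrite !inE xe xX.
by move=> eN _ xe; case/negP: xN; apply/bigcupP; exists e.
Qed.

Lemma swap_misses_out X M N x : x \notin cover M -> x \notin X ->
  x \notin cover (swap X M N).
Proof.
move=> xM xX; apply/bigcupP => -[e]; rewrite !inE.
case/orP=> /andP[]; last by move=> _ /subsetP eX /eX; apply/negP.
by move=> _ eM xe; case/negP: xM; apply/bigcupP; exists e.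
Qed.

End MatchingFacts.

(** * Optimal matchings for the lowered weights miss at most one vertex of a component *)

Section Exchange.
Variables (V : finType) (P : {set {set V}}) (C : {set V}).
Implicit Types (M N : {set {set V}}) (X e : {set V}).
Hypothesis simpleP : simple_graph P.
Hypothesis closedC : forall e x, e \in P -> x \in e -> x \in C -> e \subset C.

(** The bound on [#|X|] is the one satisfied by connected vertex sets. A largest [X] subject to it
    is separated: an edge leaving [X] would bring in one new vertex and at least one new edge. *)
Lemma exists_alternating_component M N t : M \subset P -> N \subset P -> t \in C ->
  exists X, [/\ t \in X, X \subset C, separated X (M :|: N)
             & (#|X| <= #|(M :|: N) ::&: X|.+1)%N].
Proof.
move=> sM sN tC.
pose ok X := [&& t \in X, X \subset C & (#|X| <= #|(M :|: N) ::&: X|.+1)%N].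
have ok1 : ok [set t] by rewrite /ok set11 sub1set tC cards1.
case: (arg_maxnP (fun X : {set V} => #|X|) ok1) => X /and3P[tX XC leX] maxX.
exists X; split=> // e eMN; apply/norP => -[/subsetPn[z ze zX]].
rewrite -setI_eq0 => /set0Pn[x /setIP[xe xX]].
have eP : e \in P by case/setUP: eMN; [exact: (subsetP sM) | exact: (subsetP sN)].
have ezx : e = [set z; x].
  apply/eqP; rewrite eq_sym eqEcard subUset !sub1set ze xe simpleP //= cards2.
  by case: eqP zX => // ->; rewrite xX.
suff okX : ok (z |: X) by have := maxX _ okX; rewrite /= cardsU1 zX add1n ltnn.
apply/and3P; split; first by rewrite inE tX orbT.
  by rewrite subUset sub1set XC (subsetP (closedC eP xe (subsetP XC x xX))).
rewrite cardsU1 zX add1n ltnS; apply: leq_trans leX _.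
have eN : e \notin (M :|: N) ::&: X.
  by rewrite inE negb_and; apply/orP; right; apply/subsetPn; exists z.
rewrite -add1n -[1%N]/(true : nat) -eN -cardsU1; apply: subset_leq_card.
apply/subsetP => f; rewrite in_setU1 => /orP[/eqP->|].
  by rewrite inE eMN ezx subUset !sub1set !inE eqxx xX orbT.
by rewrite !inE => /andP[-> fX]; rewrite (subset_trans fX) // subsetUr.
Qed.

Variable w : {set V} -> nat.
Hypothesis w_gt0 : forall e, e \in P -> (0 < w e)%N.
Let w1 e : nat := (w e - (e \subset C))%N.

(** Cardinality breaks ties because an edge inside [C] may have lowered weight 0; adding it must
    still count as an improvement. *)
Definition lexmax M : Prop :=
  [/\ matching P M, forall N, matching P N -> (weight w1 N <= weight w1 M)%N
    & forall N, matching P N -> weight w1 N = weight w1 M -> (#|N| <= #|M|)%N].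

Lemma exists_lexmax : exists M, lexmax M.
Proof.
case: (arg_maxnP (weight w1) (matching0 P)) => M0 mM0 max0.
pose Q M := matching P M && (weight w1 M == weight w1 M0).
have QM0 : Q M0 by rewrite /Q mM0 eqxx.
case: (arg_maxnP (fun M : {set {set V}} => #|M|) QM0) => M /andP[mM /eqP wM] max1.
exists M; split=> // [N mN|N mN wN]; first by rewrite wM; exact: max0.
by apply: max1; rewrite /Q mN wN wM eqxx.
Qed.

Lemma lexmax_nonadjacent M u t : lexmax M -> u \notin cover M -> t \notin cover M ->
  [set u; t] \in P -> False.
Proof.
move=> [mM max1 max2] uM tM utP; have /andP[sM trivM] := mM.
have utM : [set u; t] \notin M.
  by apply/negP => utM; case/negP: uM; apply/bigcupP; exists [set u; t]; rewrite ?set21.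
have mM' : matching P ([set u; t] |: M).
  rewrite /matching subUset sub1set utP sM /=.
  have [] := @trivIsetU1 _ [set u; t] M => //.
  - move=> e eM; rewrite -setI_eq0; apply/eqP/setP => x; rewrite !inE.
    apply/negbTE/negP => /andP[/orP[/eqP->|/eqP->] xe].
      by case/negP: uM; apply/bigcupP; exists e.
    by case/negP: tM; apply/bigcupP; exists e.
  - by apply/negP => /(subsetP sM)/simpleP; rewrite cards0.
have wM' : weight w1 ([set u; t] |: M) = (w1 [set u; t] + weight w1 M)%N.
  by rewrite /weight big_setU1.
have eqw : weight w1 ([set u; t] |: M) = weight w1 M.
  by have := max1 _ mM'; clear -wM'; lia.
by have := max2 _ mM' eqw; rewrite cardsU1 utM add1n ltnn.
Qed.

Lemma weight_sub_in X M : M \subset P -> X \subset C ->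
  (weight w1 (M ::&: X) + #|M ::&: X| = weight w (M ::&: X))%N.
Proof.
move=> sM XC; rewrite /weight -sum1_card -big_split /=; apply: eq_bigr => e.
rewrite inE => /andP[/(subsetP sM)/w_gt0 we eX]; rewrite /w1 (subset_trans eX XC).
by rewrite subnK.
Qed.

Hypothesis missed : forall t, t \in C -> exists N,
  [/\ matching P N, t \notin cover N
    & forall N', matching P N' -> (weight w N' <= weight w N)%N].

(** Induction along the path, [t] being the vertex after [u]. Exchanging [M] inside [X] with a
    maximum weight matching that misses [t] gives a [lexmax] matching missing [t]. If [u] is outside
    [X], the adjacent [u] and [t] are both missed; if the end of the path is outside, the path from
    [t] is shorter; if both are inside, [X] has too few edges. *)
Lemma lexmax_misses_le1 q u M : lexmax M ->
  path (fun x y => [set x; y] \in P) u q -> u \in C -> u != last u q ->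
  u \notin cover M -> last u q \notin cover M -> False.
Proof.
elim: q u M => [|t q IHq] u M lexM /=; first by rewrite eqxx.
case/andP=> utP qpath uC uv uM vM.
have tC : t \in C.
  by apply: (subsetP (closedC utP (set21 u t) uC)); rewrite set22.
have [tM|tM] := boolP (t \in cover M); last exact: (lexmax_nonadjacent lexM uM tM).
have [mM max1 max2] := lexM; have /andP[sM trivM] := mM.
have [N [mN tN maxN]] := missed tC; have /andP[sN trivN] := mN.
have [X [tX XC sepX leX]] := exists_alternating_component sM sN tC.
have sepM : separated X M by move=> e eM; apply: sepX; rewrite inE eM.
have sepN : separated X N by move=> e eN; apply: sepX; rewrite inE eN orbT.
have card_in (K : {set {set V}}) (Y : {set V}) : K \subset P -> trivIset K ->
    (forall y, y \in Y -> y \notin cover K) -> Y \subset X ->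
    (2 * #|K ::&: X| <= #|X| - #|Y|)%N.
  move=> sK trivK YK YX; rewrite -card_cover2 ?trivIsetI //; last first.
    by move=> e; rewrite inE => /andP[/(subsetP sK)/simpleP].
  rewrite -(setIidPr YX) -cardsD; apply: subset_leq_card.
  apply/subsetP => y yc; have := subsetP (cover_setI _ _) y yc.
  by rewrite !inE => /andP[yK ->]; rewrite andbT; apply/negP => /YK; rewrite yK.
have leU : (#|(M :|: N) ::&: X| <= #|M ::&: X| + #|N ::&: X|)%N.
  rewrite -cardsUI; apply: leq_trans (leq_addr _ _); apply: subset_leq_card.
  by apply/subsetP => e; rewrite !inE => /andP[/orP[]-> ->] //; rewrite orbT.
have X0 : (0 < #|X|)%N by apply/card_gt0P; exists t.
have cN : (2 * #|N ::&: X| <= #|X| - 1)%N.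
  have := card_in N [set t] sN trivN; rewrite cards1 sub1set; apply=> //.
  by move=> y /set1P->.
(* Since [N] misses [t], it has at most half of the [#|X| - 1] edges that [leX] and [leU]
   require. *)
have leNM : (#|N ::&: X| <= #|M ::&: X|)%N.
  by clear -leX leU cN X0; lia.
have wMN : (weight w (M ::&: X) <= weight w (N ::&: X))%N.
  have := maxN _ (matching_swap mN mM sepN sepM).
  by have := weight_swap w X N M; clear; lia.
have mM' := matching_swap mM mN sepM sepN.
have [eM eN] := (weight_sub_in sM XC, weight_sub_in sN XC).
have sw := weight_swap w1 X M N.
have sc := weight_swap (fun=> 1%N) X M N; rewrite !weight_card in sc.
have le1 := max1 _ mM'.
(* Inside [X] the matching [N] is at least as heavy as [M] for [w] and has no more edges, so the
   exchange cannot lower [w1]; maximality of [M] makes all these inequalities equalities. *)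
have wM' : weight w1 (swap X M N) = weight w1 M.
  by clear -sw le1 eM eN wMN leNM; lia.
have cM' : #|swap X M N| = #|M|.
  by clear -sw sc wM' eM eN wMN leNM; lia.
have lexM' : lexmax (swap X M N).
  by split=> // K mK; rewrite wM' ?cM'; [exact: max1 | exact: max2].
have tM' := swap_misses tN tX sepM.
have [uX|uX] := boolP (u \in X); last first.
  exact: (lexmax_nonadjacent lexM' (swap_misses_out N uM uX) tM' utP).
have [vX|vX] := boolP (last t q \in X); last first.
  apply: (IHq t _ lexM' qpath tC _ tM' (swap_misses_out N vM vX)).
  by apply: contraNneq vM => <-.
have uvX : [set u; last t q] \subset X by rewrite subUset !sub1set uX.
have X2 : (2 <= #|X|)%N by have := subset_leq_card uvX; rewrite cards2 uv.
(* Missing two vertices of [X], [M] has at most [(#|X| - 2) / 2] edges there and [N] at most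
   [(#|X| - 1) / 2], contradicting [leX]. *)
suff : (2 * #|M ::&: X| <= #|X| - 2)%N.
  by clear -leX leU cN X2; lia.
have := card_in M [set u; last t q] sM trivM; rewrite cards2 uv; apply=> //.
by move=> y /set2P[]->.
Qed.

End Exchange.

(** * Strong duality for matchings and odd-set covers *)

Section Duality.
Variables (R : realType) (V : finType).
Implicit Types (E : {set {set V}}) (w : {set V} -> nat) (d : odd_sets_dual R V).

Definition dual_load d (e : {set V}) : R :=
  \sum_(v in e) dual_y d v
  + \sum_(S : {set V} | odd #|S| && (e \subset S)) dual_z d S.

Definition add_dual d d' : odd_sets_dual R V :=
  OddSetsDual (fun v => dual_y d v + dual_y d' v) (fun S => dual_z d S + dual_z d' S).

Lemma cover_value_add d d' : cover_value (add_dual d d') = cover_value d + cover_value d'.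
Proof.
rewrite /cover_value /= big_split /= [RHS]addrACA; congr (_ + _).
by rewrite -big_split /=; apply: eq_bigr => S _; rewrite mulrDr.
Qed.

Lemma add_cover w w1 w2 E d1 d2 : odd_set_cover w1 E d1 -> odd_set_cover w2 E d2 ->
  (forall e, e \in E -> (w e <= w1 e + w2 e)%N) -> odd_set_cover w E (add_dual d1 d2).
Proof.
move=> [y1 z1 c1] [y2 z2 c2] le_w; split=> [v|S oS|e eE] /=.
- by rewrite addr_ge0.
- by rewrite addr_ge0 ?z1 ?z2.
rewrite /covered /= !big_split /= addrACA.
apply: (@le_trans _ _ ((w1 e + w2 e)%:R)); first by rewrite ler_nat le_w.
by rewrite natrD lerD //; [exact: c1 | exact: c2].
Qed.

Lemma star_cover E u : exists d,
  odd_set_cover (fun e => u \in e) E d /\ cover_value d = 1.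
Proof.
exists (OddSetsDual (fun v => (v == u)%:R) (fun=> 0)); split.
  split=> // e eE.
  rewrite /covered /= [X in _ + X]big1 // addr0.
  have [ue|//] := boolP (u \in e); last by rewrite sumr_ge0.
  by rewrite (bigD1 u) //= eqxx lerDl sumr_ge0.
rewrite /cover_value /= [X in _ + X]big1 ?addr0; last by move=> S _; rewrite mulr0.
by rewrite (bigD1 u) //= eqxx big1 ?addr0 // => v /negPf->.
Qed.

(** An odd [C] takes one odd-set variable; an even [C] takes 1/2 on each of its vertices, which
    gives the value [#|C| / 2]. *)
Lemma blossom_cover E (C : {set V}) : simple_graph E -> exists d,
  odd_set_cover (fun e => e \subset C) E d /\ cover_value d = #|C|./2%:R.
Proof.
move=> simpleE; have [oC|eC] := boolP (odd #|C|).
  exists (OddSetsDual (fun=> 0) (fun S => (S == C)%:R)); split.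
    split=> // e eE.
    rewrite /covered /= big1 // add0r.
    have [eC|//] := boolP (e \subset C); last by rewrite sumr_ge0.
    by rewrite (bigD1 C) ?oC //= eqxx lerDl sumr_ge0.
  rewrite /cover_value /= big1 // add0r (bigD1 C) //= eqxx mulr1 big1 ?addr0; last first.
    by move=> S /andP[_ /negPf->]; rewrite mulr0.
  have -> : #|C|%:R = 1 + 2 * #|C|./2%:R :> R.
    by rewrite -[in LHS](odd_double_half #|C|) oC -mul2n natrD natrM.
  by lra.
have half_ge0 v : 0 <= (if v \in C then 1 / 2 else 0) :> R by case: ifP => _; lra.
exists (OddSetsDual (fun v => if v \in C then 1 / 2 else 0) (fun=> 0)); split.
  split=> // e eE.
  rewrite /covered /= [X in _ + X]big1 // addr0.
  have [eC'|//] := boolP (e \subset C); last by rewrite sumr_ge0.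
  rewrite (eq_bigr (fun=> 1 / 2)); last by move=> v /(subsetP eC')->.
  rewrite sumr_const simpleE // -[leRHS]mulr_natl -[leLHS]/(1 : R); lra.
rewrite /cover_value /= [X in _ + X]big1 ?addr0; last by move=> S _; rewrite mulr0.
have CE : #|C|%:R = 2 * #|C|./2%:R :> R.
  by rewrite -[in LHS](odd_double_half #|C|) (negPf eC) add0n -mul2n natrM.
by rewrite -big_mkcond sumr_const -[LHS]mulr_natl CE; lra.
Qed.

Lemma weight_lt w w' E e : (forall f, (w' f <= w f)%N) -> e \in E ->
  (w' e < w e)%N -> (weight w' E < weight w E)%N.
Proof.
move=> le_w eE lt_e; rewrite /weight (bigD1 e) //= [X in (_ < X)%N](bigD1 e) //=.
by rewrite -addSn leq_add // leq_sum.
Qed.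

(* Schrijver's direct proof of the Cunningham-Marsh formula, by induction on
   the total weight. Either some vertex u lies on all maximum weight matchings,
   and the weights at u can be lowered, or the weights within a component C of
   the support can be lowered: then an optimal matching for the lowered weights
   misses at most one vertex of C. *)
Theorem exists_cover_le_mu w E : simple_graph E ->
  exists d, odd_set_cover w E d /\ cover_value d <= (mu w E)%:R.
Proof.
move=> simpleE; have [m] := ubnP (weight w E); elim: m w => // m IHm w; rewrite ltnS => le_wm.
pose P := positive_edges E w.
have sPE : P \subset E by apply/subsetP => e; rewrite inE => /andP[].
have off e : e \in E -> e \notin P -> w e = 0%N.
  by rewrite inE => -> /=; rewrite -leqNgt leqn0 => /eqP.
have simpleP : simple_graph P by move=> e /(subsetP sPE)/simpleE.
have w_gt0 e : e \in P -> (0 < w e)%N by rewrite inE => /andP[].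
have muP : mu w P = mu w E by exact: mu_support.
(* Common end of both cases: a cover for the lowered weights is added to a cover [d2] of the
   decrement, whose value [c] must not exceed the drop of [mu]. *)
have step w1 w2 d2 c : (forall e, e \in E -> (w e <= w1 e + w2 e)%N) ->
    (weight w1 E < weight w E)%N -> odd_set_cover w2 E d2 -> cover_value d2 = c%:R ->
    (mu w1 E + c <= mu w E)%N ->
    exists d, odd_set_cover w E d /\ cover_value d <= (mu w E)%:R.
  move=> le_w lt_w cov2 val2 le_mu; have [|d1 [cov1 val1]] := IHm w1.
    exact: leq_trans lt_w le_wm.
  exists (add_dual d1 d2); split; first exact: add_cover cov1 cov2 le_w.
  by rewrite cover_value_add val2; apply: le_trans (lerD val1 (lexx _)) _; rewrite -natrD ler_nat.
case: (boolP [exists u, [forall M : {set {set V}},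
         (matching P M && (weight w M == mu w P)) ==> (u \in cover M)]]).
  case/existsP=> u /forallP uall.
  have uM M : matching P M -> weight w M = mu w P -> u \in cover M.
    by move=> mM wM; have /implyP := uall M; apply; rewrite mM wM eqxx.
  pose w1 e : nat := (w e - (u \in e))%N.
  have [d2 [cov2 val2]] := star_cover E u.
  apply: (step w1 (fun e => u \in e) d2 1%N) => //.
  - by move=> e _; rewrite /w1 addnC -leq_subLR.
  - have [M mM /(uM _ mM)/bigcupP[e eM ue]] := mu_attained w P.
    have eP : e \in P by case/andP: mM => /subsetP sM _; exact: sM.
    apply: (weight_lt (e := e)) => [f||]; first by rewrite leq_subr.
      exact: (subsetP sPE).
    by rewrite /w1 ue; have := w_gt0 e eP; clear; lia.
  have [M mM wM] := mu_attained w1 E; have /andP[sME _] := mM.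
  have mMP : matching P (M :&: P) by have := matchingI P mM; rewrite (setIidPr sPE).
  rewrite -wM -(@weightI _ w1 E P M sME); last by move=> e eE eP; rewrite /w1 off.
  have le1 : (weight w1 (M :&: P) <= weight w (M :&: P))%N.
    by apply: leq_sum => e _; rewrite leq_subr.
  have leP := weight_le_mu w mMP; rewrite -muP.
  (* If the matching is not optimal for [w], it is already 1 below the maximum; otherwise it covers
     [u] and loses 1 at that edge. *)
  have [wP|wP] := eqVneq (weight w (M :&: P)) (mu w P); last first.
    by clear -le1 leP wP; lia.
  have /bigcupP[e eMP ue] := uM _ mMP wP.
  rewrite addn1 -wP; apply: (weight_lt (e := e)) => [f||] //; first by rewrite leq_subr.
  rewrite /w1 ue; have : (0 < w e)%N by apply: w_gt0; case/setIP: eMP.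
  by clear; lia.
rewrite negb_exists => /forallP missed.
have [P0|/set0Pn[e0 e0P]] := eqVneq P set0.
  exists (OddSetsDual (fun=> 0) (fun=> 0)); split.
    split=> // e eE; rewrite /covered /= !big1 // addr0 off // P0 inE //.
  by rewrite /cover_value /= !big1 ?addr0 ?ler0n // => S _; rewrite mulr0.
have /eqP/cards2P[x0 [x1 [_ e0E]]] := simpleP e0 e0P.
pose adj : rel V := fun x y => [set x; y] \in P.
pose C := [set x | connect adj x0 x].
have adjC x y : x \in C -> adj x y -> y \in C.
  by rewrite !inE => x0x xy; apply: connect_trans x0x (connect1 xy).
have symadj : connect_sym adj by apply: sym_connect_sym => x y; rewrite /adj setUC.
have closedC e x : e \in P -> x \in e -> x \in C -> e \subset C.
  move=> eP xe xC; apply/subsetP => y ye.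
  have [<-//|xy] := eqVneq x y; apply: (adjC x) => //.
  rewrite /adj (_ : [set x; y] = e) //; apply/eqP.
  by rewrite eqEcard subUset !sub1set xe ye simpleP // cards2 xy.
have e0C : e0 \subset C.
  by apply: (closedC e0 x0) => //; rewrite ?inE ?connect0 // e0E set21.
have missed' t : t \in C -> exists N, [/\ matching P N, t \notin cover N
    & forall N', matching P N' -> (weight w N' <= weight w N)%N].
  move=> _; have := missed t; rewrite negb_forall => /existsP[N].
  rewrite negb_imply => /andP[/andP[mN /eqP wN] tN]; exists N; split=> // N' mN'.
  by rewrite wN weight_le_mu.
have [M lexM] := exists_lexmax P C w.
have misses u v : u \in C -> v \in C -> u \notin cover M -> v \notin cover M -> u = v.
  move=> uC vC uM vM; apply/eqP/negP => /negP uv.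
  have /connectP[q qpath qv] : connect adj u v.
    by move: uC vC; rewrite !inE [connect adj x0 u]symadj; exact: connect_trans.
  rewrite qv in uv vM.
  exact: (@lexmax_misses_le1 _ P C simpleP closedC w w_gt0 missed' q u M).
have [mM max1 _] := lexM; have /andP[sM trivM] := mM.
pose w1 e : nat := (w e - (e \subset C))%N.
have [d2 [cov2 val2]] := blossom_cover C simpleE.
apply: (step w1 (fun e => e \subset C) d2 #|C|./2) => //.
- by move=> e _; rewrite /w1 addnC -leq_subLR.
- apply: (weight_lt (e := e0)) => [f||]; first by rewrite leq_subr.
    exact: (subsetP sPE).
  by rewrite /w1 e0C; have := w_gt0 e0 e0P; clear; lia.
have -> : mu w1 E = weight w1 M.
  rewrite -(@mu_support _ w1 E P) //; last by move=> e eE eP; rewrite /w1 off.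
  apply/eqP; rewrite eqn_leq weight_le_mu // andbT.
  by have [N mN <-] := mu_attained w1 P; exact: max1.
have wM : weight w M = (weight w1 M + #|M ::&: C|)%N.
  rewrite /weight -sum1_card (big_mkcond (fun e => e \in M ::&: C)) /=.
  rewrite [X in (_ + X)%N](_ : _ = \sum_(e in M) (e \subset C))%N; last first.
    rewrite [RHS]big_mkcond /=; apply: eq_bigr => e _; rewrite !inE.
    by case: (e \in M) => //=; case: (e \subset C).
  rewrite -big_split /=; apply: eq_bigr => e /(subsetP sM)/w_gt0 we.
  by rewrite /w1 subnK //; case: (e \subset C).
(* All but at most one vertex of [C] are matched within [C], so lowering the weights costs [M] at
   least [#|C|./2]. *)
have leC : (#|C| <= 2 * #|M ::&: C| + 1)%N.
  rewrite -card_cover2 ?trivIsetI //; last first.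
    by move=> e; rewrite inE => /andP[/(subsetP sM)/simpleP].
  rewrite -(cardsID (cover (M ::&: C)) C) leq_add ?subset_leq_card ?subsetIr //.
  apply/card_le1_eqP => u v.
  have cov x : x \in C -> x \in cover M -> x \in cover (M ::&: C).
    move=> xC /bigcupP[e eM xe]; apply/bigcupP; exists e => //.
    by rewrite inE eM (closedC e x) // (subsetP sM).
  move=> /setDP[uC uM] /setDP[vC vM]; apply: misses => //.
    by apply: contra vM; exact: cov.
  by apply: contra uM; exact: cov.
have := weight_le_mu w mM; rewrite muP wM; clear -leC; lia.
Qed.

End Duality.

(** * Weak duality for partial covers *)

Section WeakDuality.
Variables (R : realType) (V : finType).
Implicit Types (E M : {set {set V}}) (w : {set V} -> nat) (d : odd_sets_dual R V).

(** The total load of [M] is at most the cover value, an odd [S] containing at most [(#|S| - 1) / 2]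
    edges of [M]; the uncovered edges have nonnegative load. *)
Lemma covered_weight_le w E d M : simple_graph E -> matching E M ->
  (forall v, 0 <= dual_y d v) ->
  (forall S : {set V}, odd #|S| -> 0 <= dual_z d S) ->
  \sum_(e in M | covered w d e) (w e)%:R <= cover_value d.
Proof.
move=> simpleE /andP[/subsetP sM trivM] y0 z0.
apply: (@le_trans _ _ (\sum_(e in M) dual_load d e)).
  rewrite [leRHS](bigID (covered w d)) /= -[leLHS]addr0 lerD ?ler_sum //.
    by move=> e /andP[].
  apply: sumr_ge0 => e _; apply: addr_ge0; apply: sumr_ge0 => // S /andP[oS _].
  exact: z0.
rewrite big_split /= /cover_value lerD //.
  rewrite -(big_trivIset _ trivM) /= [leRHS](bigID (mem (cover M))) /= lerDl.
  exact: sumr_ge0.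
rewrite (exchange_big_dep (fun S : {set V} => odd #|S|)) /=; last by move=> e S _ /andP[].
apply: ler_sum => S oS.
rewrite (eq_bigl (mem (M ::&: S))); last by move=> e; rewrite oS /= !inE.
rewrite sumr_const -[leLHS]mulr_natl ler_wpM2r ?z0 //.
have leS : (2 * #|M ::&: S| < #|S|)%N.
  have : (2 * #|M ::&: S| <= #|S|)%N.
    rewrite -card_cover2 ?trivIsetI //; last by move=> e; rewrite inE => /andP[/sM/simpleE].
    by apply: subset_leq_card; apply: subset_trans (cover_setI _ _) (subsetIr _ _).
  by move: oS; lia.
by rewrite ler_pdivlMr // mulrC -natrM lerBrDr natr1 ler_nat.
Qed.

End WeakDuality.

(** * Probabilities of sampled histories *)

Section TupleSums.
Variables (R : nmodType) (T : finType).

Lemma big_tupleS k (F : seq T -> R) :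
  \sum_(h : k.+1.-tuple T) F h = \sum_(h : k.-tuple T) \sum_x F (x :: h).
Proof.
rewrite pair_big /= (reindex (fun ht : k.-tuple T * T => [tuple of ht.2 :: ht.1])) //=.
exists (fun t : k.+1.-tuple T => ([tuple of behead t], thead t)) => [[h x] _|t _] /=.
  by rewrite theadE; congr (_, _); apply: val_inj.
by rewrite -tuple_eta.
Qed.

End TupleSums.

Section Sampling.
Variables (R : realType) (V : finType) (E : {set {set V}}).
Variables (w : {set V} -> nat) (eps : R) (A : solver R V).
Implicit Types (h : history V) (S U : {set {set V}}).
Hypothesis eps_gt0 : 0 < eps.

Local Notation W := (total_weight E w).
Local Notation n := #|V|.
Local Notation q := (importance w A).
Local Notation Q := (total_importance E w A).
Local Notation prob := (edge_prob E w eps A).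
Local Notation sprob := (sample_prob E w eps A).
Local Notation hprob := (history_prob E w eps A).

Definition rate : R := 8 * n%:R * ln (n%:R * W%:R) / eps.

Lemma rate_ge0 : 0 <= rate.
Proof.
apply: divr_ge0 (ltW eps_gt0); apply: mulr_ge0; first by rewrite mulr_ge0.
rewrite -natrM.
by case: (n * W)%N => [|m]; [rewrite ln0 | rewrite ln_ge0 // ler1n].
Qed.

Lemma importance_gt0 h e : 0 < q h e.
Proof. by elim: h => //= S h IHh; case: ifP => // _; rewrite mulr_gt0. Qed.

Lemma total_importance_ge0 h : 0 <= Q h.
Proof. by apply: sumr_ge0 => e _; rewrite mulr_ge0 // ltW // importance_gt0. Qed.

Lemma edge_prob_ge0 h e : 0 <= prob h e.
Proof.
rewrite /edge_prob le_min ler01 /= mulr_ge0 ?rate_ge0 // divr_ge0 ?total_importance_ge0 //.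
by rewrite mulr_ge0 // ltW // importance_gt0.
Qed.

Lemma edge_prob_le1 h e : prob h e <= 1.
Proof. by rewrite /edge_prob ge_min lexx. Qed.

Lemma sample_prob_ge0 h S : 0 <= sprob h S.
Proof.
rewrite /sample_prob; case: ifP => // _; apply: prodr_ge0 => e _.
by case: ifP => _; rewrite ?edge_prob_ge0 // subr_ge0 edge_prob_le1.
Qed.

Lemma history_prob_ge0 h : 0 <= hprob h.
Proof. by elim: h => //= S h IHh; rewrite mulr_ge0 // sample_prob_ge0. Qed.

Lemma sum_sample_prob_disjoint h U : U \subset E ->
  \sum_(S : {set {set V}} | [disjoint S & U]) sprob h S = \prod_(e in U) (1 - prob h e).
Proof.
move=> sUE.
(* Distributing [\prod_e (F e + G e)] yields one term per set [S]; the zeros of [F] cancel every [S]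
   that meets [U] or leaves [E]. *)
pose F e := if (e \in E) && (e \notin U) then prob h e else 0.
pose G e := if e \in E then 1 - prob h e else 1.
have -> : \prod_(e in U) (1 - prob h e) = \prod_e (F e + G e).
  rewrite big_mkcond; apply: eq_bigr => e _; rewrite /F /G.
  case: (boolP (e \in U)) => [/(subsetP sUE)->|_]; rewrite ?andbT ?andbF ?add0r //=.
  by case: ifP => _; rewrite ?add0r // addrC subrK.
rewrite bigA_distr /= big_mkcond; apply: eq_bigr => S _; rewrite /sample_prob.
have [dSU|/pred0Pn[e /andP[/= eS eU]]] := boolP [disjoint S & U]; last first.
  by rewrite (bigD1 e) //= eS /F eU andbF mul0r.
have [sSE|/subsetPn[e eS eE]] := boolP (S \subset E); last first.
  by rewrite (bigD1 e) //= eS /F (negPf eE) mul0r.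
rewrite big_mkcond; apply: eq_bigr => e _; rewrite /F /G.
have [eS|eS] := boolP (e \in S); last by case: ifP.
by rewrite (subsetP sSE) //= (disjointFr dSU eS).
Qed.

Lemma sum_sample_prob h : \sum_S sprob h S = 1.
Proof.
transitivity (\prod_(e in (set0 : {set {set V}})) (1 - prob h e)); last first.
  by rewrite big_set0.
rewrite -(sum_sample_prob_disjoint h (sub0set E)); apply: eq_bigl => S.
by rewrite -setI_eq0 setI0 eqxx.
Qed.

Lemma sum_history_prob k : \sum_(h : k.-tuple {set {set V}}) hprob h = 1.
Proof.
elim: k => [|k IHk].
  rewrite (big_pred1 [tuple]) //= => t.
  by rewrite [t]tuple0 /= eqxx.
rewrite big_tupleS -[RHS]IHk; apply: eq_bigr => h _ /=.
by rewrite -mulr_suml sum_sample_prob mul1r.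
Qed.

Fixpoint occurs (bad : pred (history V)) h : bool :=
  if h is _ :: h' then bad h || occurs bad h' else false.

(** Union bound over the rounds, peeling off the latest one: after each history it is bad with
    conditional probability at most [b]. *)
Lemma sum_occurs_le (bad : pred (history V)) (b : R) k :
  (forall h, \sum_(S | bad (S :: h)) sprob h S <= b) ->
  \sum_(h : k.-tuple {set {set V}} | occurs bad h) hprob h <= k%:R * b.
Proof.
move=> bad_le; elim: k => [|k IHk].
  by rewrite big1 ?mul0r // => h; rewrite tuple0.
rewrite big_mkcond /= (big_tupleS k (fun h => if occurs bad h then hprob h else 0)) /=.
apply: (@le_trans _ _ (\sum_(h : k.-tuple {set {set V}})
    (b * hprob h + (if occurs bad h then hprob h else 0)))).
  apply: ler_sum => h _.
  apply: (@le_trans _ _ (\sum_S ((if bad (S :: h) then sprob h S else 0) * hprob h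
           + sprob h S * (if occurs bad h then hprob h else 0)))).
    apply: ler_sum => S _.
    have := sample_prob_ge0 h S; have := history_prob_ge0 h.
    case: (bad _); case: (occurs _ _) => /= h0 s0; nra.
  rewrite big_split /= -!mulr_suml sum_sample_prob mul1r lerD2r.
  by rewrite ler_wpM2r ?history_prob_ge0 // -big_mkcond /=.
rewrite big_split /= -mulr_sumr sum_history_prob mulr1 -[k.+1%:R]natr1 mulrDl mul1r addrC.
by rewrite lerD2r -big_mkcond.
Qed.

(** * Probability of a bad round and growth of the importance *)

Hypothesis simpleE : simple_graph E.
Hypothesis validA : valid_solver E w A.

Definition heavy h U : bool :=
  eps / 2 * Q h < \sum_(e in U) (w e)%:R * q h e.

Definition bad_round h : bool :=
  if h is S0 :: h' then (S0 \subset E) && heavy h' (uncovered E w (solve_cover A h))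
  else false.

Lemma importance_cons S h e :
  q (S :: h) e = if covered w (solve_cover A (S :: h)) e then q h e else 2 * q h e.
Proof. by []. Qed.

Lemma uncovered_disjoint S h : S \subset E ->
  [disjoint S & uncovered E w (solve_cover A (S :: h))].
Proof.
move=> sSE; have [_ [[_ _ cov] _] _] := validA h sSE.
rewrite -setI_eq0; apply/eqP/setP => e; rewrite !inE.
by case: (boolP (e \in S)) => // eS; rewrite cov // andbF.
Qed.

Lemma one_sub_min_le_expR (x : R) : 1 - Num.min 1 x <= expR (- x).
Proof.
case: (leP 1 x) => _; first by rewrite subrr expR_ge0.
exact: expR_ge1Dx.
Qed.

(** As [1 - min(1, x) <= exp(-x)], the exponents add up to [rate] times the share of [U] in [Q h],
    which exceeds [eps / 2]. *)
Lemma heavy_missed_le h U : 0 < Q h -> heavy h U ->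
  \prod_(e in U) (1 - prob h e) <= expR (- (rate * (eps / 2))).
Proof.
move=> Q0 hU.
apply: (@le_trans _ _ (\prod_(e in U) expR (- (rate * (q h e * (w e)%:R / Q h))))).
  apply: ler_prod => e _; rewrite subr_ge0 edge_prob_le1 /=.
  exact: one_sub_min_le_expR.
rewrite -expR_sum ler_expR sumrN lerN2 -mulr_sumr ler_wpM2l ?rate_ge0 //.
rewrite -mulr_suml ler_pdivlMr // ltW //; apply: lt_le_trans hU _.
by rewrite le_eqVlt; apply/orP; left; apply/eqP/eq_bigr => e _; rewrite mulrC.
Qed.

(** The uncovered set depends on the sample, but it avoids the sample and belongs to
    [uncovered_family], which is fixed in advance; hence a union bound over this family. *)
Lemma sum_bad_round_le h : 0 < Q h ->
  \sum_(S | bad_round (S :: h)) sprob h S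
    <= #|uncovered_family R E w|%:R * expR (- (rate * (eps / 2))).
Proof.
move=> Q0; set UF := uncovered_family R E w.
pose ok U := [&& U \in UF, U \subset E & heavy h U].
apply: (@le_trans _ _ (\sum_(S : {set {set V}})
    \sum_(U : {set {set V}} | ok U && [disjoint S & U]) sprob h S)).
  rewrite big_mkcond; apply: ler_sum => S _.
  have ge0 (P : pred {set {set V}}) : 0 <= \sum_(U | P U) sprob h S.
    by apply: sumr_ge0 => U _; exact: sample_prob_ge0.
  case: ifP => // /andP[sSE hU].
  set U := uncovered E w (solve_cover A (S :: h)) in hU.
  have okU : ok U && [disjoint S & U].
    rewrite uncovered_disjoint // andbT /ok hU andbT; apply/andP; split.
      by have [_ [[y0 z0 _] _] lam] := validA h sSE; exact: uncovered_in_family.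
    by apply/subsetP => e; rewrite inE => /andP[].
  by rewrite (bigD1 U) //= lerDl; exact: ge0.
rewrite (exchange_big_dep ok) /=; last by move=> S U _ /andP[].
apply: (@le_trans _ _ (\sum_(U | ok U) expR (- (rate * (eps / 2))))).
  apply: ler_sum => U okU; have /and3P[_ sUE hU] := okU.
  rewrite (eq_bigl (fun S : {set {set V}} => [disjoint S & U])); last by move=> S; rewrite okU.
  by rewrite sum_sample_prob_disjoint // heavy_missed_le.
rewrite sumr_const -[leLHS]mulr_natl ler_wpM2r ?expR_ge0 // ler_nat.
by apply: subset_leq_card; apply/subsetP => U; rewrite unfold_in => /and3P[].
Qed.

Lemma total_importance_cons_le S h : ~~ bad_round (S :: h) -> S \subset E ->
  Q (S :: h) <= (1 + eps / 2) * Q h.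
Proof.
rewrite /= => nbad sSE; move: nbad; rewrite sSE /= -leNgt => le_unc.
rewrite mulrDl mul1r; apply: le_trans (lerD (lexx _) le_unc).
rewrite /total_importance /uncovered.
under [X in _ <= _ + X]eq_bigl do rewrite inE.
rewrite big_mkcondr -big_split /=; apply: ler_sum => e _.
case: (covered _ _ e); first by rewrite addr0.
by rewrite /= mulrCA mulr2n mulrDl mul1r.
Qed.

Lemma total_importance0 : Q [::] = W%:R.
Proof.
rewrite /total_importance /total_weight natr_sum.
by apply: eq_bigr => e _; rewrite mulr1.
Qed.

Lemma total_importance_gt0 h : (0 < W)%N -> 0 < Q h.
Proof.
move=> W0; apply: (@lt_le_trans _ _ (Q [::])); first by rewrite total_importance0 ltr0n.
elim: h => // S h IHh; apply: le_trans IHh _; apply: ler_sum => e _.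
rewrite ler_wpM2l // importance_cons; case: ifP => // _.
by rewrite mulr_natl mulr2n lerDl ltW // importance_gt0.
Qed.

Lemma total_importance_le h : all (fun S => S \subset E) h -> ~~ occurs bad_round h ->
  Q h <= (1 + eps / 2) ^+ size h * W%:R.
Proof.
elim: h => [|S h IHh]; first by rewrite total_importance0 expr0 mul1r.
case/andP=> sSE sh /norP[nbad nocc].
apply: le_trans (total_importance_cons_le nbad sSE) _.
rewrite exprS -mulrA ler_wpM2l ?IHh //.
by rewrite addr_ge0 // divr_ge0 // ltW.
Qed.

Fixpoint doublings h e : nat :=
  if h is _ :: h' then (~~ covered w (solve_cover A h) e + doublings h' e)%N else 0.

Lemma importance_doublings h e : q h e = 2 ^+ doublings h e.
Proof.
elim: h => //= S h ->; case: ifP => _ //=.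
by rewrite add1n exprS.
Qed.

Lemma cover_value_le S h : S \subset E ->
  cover_value (solve_cover A (S :: h)) <= (weight w (solve_matching A (S :: h)))%:R.
Proof.
move=> sSE; have [[mM maxM] [_ minc] _] := validA h sSE.
have simpleS : simple_graph S by move=> e /(subsetP sSE)/simpleE.
have [d [covd vald]] := exists_cover_le_mu R w simpleS.
apply: le_trans (minc d covd) (le_trans vald _); rewrite ler_nat.
by have [M /maxM leM <-] := mu_attained w S.
Qed.

(** Here [M] is a matching of the whole graph. Weak duality bounds its covered part by the cover
    value, and strong duality in the sample bounds that by the weight of the matching found. *)
Lemma uncovered_weight_ge S h M : S \subset E -> matching E M ->
  (weight w M)%:R - (weight w (solve_matching A (S :: h)))%:R <=
  \sum_(e in M | ~~ covered w (solve_cover A (S :: h)) e) (w e)%:R :> R.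
Proof.
move=> sSE mM; have [_ [[y0 z0 _] _] _] := validA h sSE.
rewrite lerBlDr; apply: le_trans (lerD (lexx _) (cover_value_le h sSE)).
apply: le_trans (lerD (lexx _) (covered_weight_le w simpleE mM y0 z0)).
by rewrite natr_sum [leLHS](bigID (covered w (solve_cover A (S :: h)))) /= addrC.
Qed.

Lemma output_ge S h :
  (weight w (solve_matching A (S :: h)) <= weight w (output w A (S :: h)))%N /\
  (weight w (output w A h) <= weight w (output w A (S :: h)))%N.
Proof.
rewrite /=; case: ifP => [le_w|/negbT]; first by split.
by rewrite -ltnNge => /ltnW lt_w; split.
Qed.

Lemma output_matching h : all (fun S => S \subset E) h -> matching E (output w A h).
Proof.
elim: h => [|S h IHh]; first by rewrite /= matching0.
case/andP=> sSE sh /=; case: ifP => _; last exact: IHh.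
by have [[mM _] _ _] := validA h sSE; exact: matchingS mM.
Qed.

Lemma history_prob_subset h : hprob h != 0 -> all (fun S => S \subset E) h.
Proof.
elim: h => //= S h IHh; rewrite mulf_eq0 negb_or => /andP[sp /IHh->].
by move: sp; rewrite /sample_prob; case: ifP => //; rewrite eqxx.
Qed.

Lemma sum_doublings_ge h M : all (fun S => S \subset E) h -> matching E M ->
  (weight w (output w A h))%:R < (1 - eps) * (weight w M)%:R ->
  (size h)%:R * eps * (weight w M)%:R <= \sum_(e in M) (w e)%:R * (doublings h e)%:R.
Proof.
move=> + mM; elim: h => [|S h IHh] /=.
  by move=> _ _; rewrite !mul0r sumr_ge0 // => e _; rewrite mulr0.
case/andP=> sSE sh lt_out.
have [ge1 ge2] := output_ge S h.
have {}IHh := IHh sh (le_lt_trans _ lt_out); rewrite ler_nat in IHh.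
have {}IHh := IHh ge2.
have lt1 : (weight w (solve_matching A (S :: h)))%:R < (1 - eps) * (weight w M)%:R.
  by apply: le_lt_trans lt_out; rewrite ler_nat.
have unc := uncovered_weight_ge h sSE mM.
under eq_bigr do rewrite natrD mulrDr.
rewrite big_split /= -natr1 !mulrDl mul1r addrC lerD //.
apply: le_trans (le_trans unc _); first by lra.
rewrite big_mkcondr /=; apply: ler_sum => e _.
by case: (covered _ _ _); rewrite ?mulr0 ?mulr1.
Qed.

(* Jensen's inequality, through the tangent of exp at the mean exponent. *)
Lemma total_importance_ge h M : matching E M ->
  (size h)%:R * eps * (weight w M)%:R <= \sum_(e in M) (w e)%:R * (doublings h e)%:R ->
  (weight w M)%:R * expR (ln 2 * (eps * (size h)%:R)) <= Q h.
Proof.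
move=> /andP[sME _] dbl; set x := ln 2 * _.
have ln2 : 0 < ln 2 :> R by rewrite ln_gt0 // ltr1n.
apply: (@le_trans _ _ (\sum_(e in M) (w e)%:R * q h e)); last first.
  rewrite /total_importance [leRHS](big_setID M) /= (setIidPr sME) lerDl.
  by apply: sumr_ge0 => e _; rewrite mulr_ge0 // ltW // importance_gt0.
apply: (@le_trans _ _ (\sum_(e in M)
    (w e)%:R * (expR x * (1 + (ln 2 * (doublings h e)%:R - x))))).
  rewrite (eq_bigr (fun e => expR x *
    ((1 - x) * (w e)%:R + ln 2 * ((w e)%:R * (doublings h e)%:R)))).
    rewrite -mulr_sumr mulrC ler_wpM2l ?expR_ge0 // big_split /= -!mulr_sumr -natr_sum.
    rewrite -/(weight w M) mulrBl mul1r -addrA lerDl addrC subr_ge0 /x -mulrA ler_pM2l //.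
    by rewrite [eps * _]mulrC.
  by move=> e _; ring.
apply: ler_sum => e _; rewrite ler_wpM2l // importance_doublings.
apply: le_trans (ler_wpM2l (expR_ge0 x) (expR_ge1Dx _)) _.
rewrite -expRD addrC subrK mulrC expRM_natl lnK //.
by rewrite posrE.
Qed.

End Sampling.

(** * Numerical estimates *)

Section Numerics.
Variable R : realType.

Lemma ln2_gt : 2 / 3 < ln 2 :> R.
Proof.
rewrite -ltr_expR lnK ?posrE //.
(* From [exp(-1/15) >= 14/15]; then [exp(2/3) <= (15/14)^10 < 2]. *)
have small : expR (1 / 15) <= 15 / 14 :> R.
  have := expR_ge1Dx (- (1 / 15) : R); rewrite expRN => le_inv.
  rewrite -[leLHS]invrK -[leRHS]invrK lef_pV2 ?posrE ?invr_gt0 ?expR_gt0 //; last by lra.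
  by apply: le_trans le_inv; lra.
have -> : 2 / 3 = 10%:R * (1 / 15) :> R by lra.
rewrite expRM_natl; apply: (@le_lt_trans _ _ ((15 / 14) ^+ 10)).
  by apply: lerXn2r => //; rewrite nnegrE ?expR_ge0 //; lra.
by lra.
Qed.

(* This is where the number (4 / eps) log_2 W of rounds and the threshold
   eps / 2 of a bad round meet. *)
Lemma growth_contradiction (eps m W : R) k : 0 < eps -> 1 <= m -> 1 < W ->
  4 / eps * (ln W / ln 2) <= k%:R ->
  m * expR (ln 2 * (eps * k%:R)) <= (1 + eps / 2) ^+ k * W -> False.
Proof.
move=> eps0 m1 W1 le_k le_growth.
have l2 := ln2_gt.
have lW : 0 < ln W by exact: ln_gt0.
have W0 : 0 < W by lra.
have upper : expR (ln 2 * (eps * k%:R)) <= expR (eps / 2 * k%:R + ln W).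
  apply: (@le_trans _ _ (m * expR (ln 2 * (eps * k%:R)))).
    by rewrite ler_peMl // expR_ge0.
  apply: le_trans le_growth _; rewrite expRD lnK ?posrE // (ler_wpM2r (ltW W0)) //.
  rewrite expRM_natr; apply: lerXn2r; rewrite ?nnegrE ?expR_ge0 //; last exact: expR_ge1Dx.
  by lra.
rewrite ler_expR in upper.
have lower : 4 * ln W <= eps * k%:R * ln 2.
  have : (4 / eps * (ln W / ln 2)) * (eps * ln 2) <= k%:R * (eps * ln 2).
    by rewrite ler_wpM2r // mulr_ge0 ?ltW //; lra.
  have -> : (4 / eps * (ln W / ln 2)) * (eps * ln 2) = 4 * ln W.
    by field; rewrite !gt_eqF //; lra.
  by move=> /le_trans; apply; lra.
(* With [x = eps * k > 0], [x * (ln 2 - 1/2) <= ln W <= x * ln 2 / 4] would give [ln 2 <= 2/3]. *)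
by nra.
Qed.

End Numerics.

(** * Number of rounds and total failure probability *)

Section Rounds.
Variables (R : realType) (V : finType) (E : {set {set V}}).
Variables (w : {set V} -> nat) (eps : R) (A : solver R V).
Implicit Types (h : history V) (S : {set {set V}}).
Hypotheses (eps_gt0 : 0 < eps) (eps_lt1 : eps < 1).
Hypothesis simpleE : simple_graph E.
Hypothesis validA : valid_solver E w A.

Local Notation W := (total_weight E w).
Local Notation n := #|V|.
Local Notation hprob := (history_prob E w eps A).

Lemma rounds_ge : 4 / eps * (ln W%:R / ln 2) <= (rounds E w eps)%:R.
Proof.
set x := 4 / eps * _; apply: le_trans (ceil_ge x) _.
rewrite pmulrn ler_int; apply: le_trans (ler_norm _) _.
by rewrite -abszE lez_nat leq_maxr.
Qed.

Lemma positive_mu : (0 < W)%N -> (0 < mu w E)%N.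
Proof.
rewrite lt0n sum_nat_eq0 negb_forall => /existsP[e].
rewrite negb_imply -lt0n => /andP[eE we].
have mM : matching E [set e] by rewrite /matching sub1set eE trivIset1.
by apply: leq_trans (weight_le_mu w mM); rewrite /weight big_set1.
Qed.

Lemma good_output h : (1 < W)%N -> size h = rounds E w eps ->
  all (fun S => S \subset E) h -> ~~ occurs (bad_round E w eps A) h ->
  (1 - eps) * (mu w E)%:R <= (weight w (output w A h))%:R.
Proof.
move=> W1 size_h sub_h good_h; rewrite leNgt; apply/negP => lt_out.
have [M mM wM] := mu_attained w E; rewrite -wM in lt_out.
have dbl := sum_doublings_ge simpleE validA sub_h mM lt_out.
have lower := total_importance_ge mM dbl.
have upper := total_importance_le eps_gt0 sub_h good_h.
apply: (@growth_contradiction R eps (weight w M)%:R W%:R (size h)).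
- by [].
- by rewrite ler1n wM positive_mu // ltnW.
- by rewrite ltr1n.
- by rewrite size_h rounds_ge.
exact: le_trans lower upper.
Qed.

(** With all importances 1, an edge of weight at least 1 has sampling rate at least [rate / W >= 1],
    so it is sampled surely. The first round is the last entry of [h], hence the induction. *)
Lemma first_round_optimal h : W%:R * eps <= 8 * n%:R * ln (n%:R * W%:R) ->
  h != [::] -> hprob h != 0 -> (mu w E <= weight w (output w A h))%N.
Proof.
move=> smallW; elim: h => // S [|S' h] IHh _; last first.
  rewrite [history_prob _ _ _ _ _]/= mulf_eq0 negb_or => /andP[_ hp].
  by apply: leq_trans (IHh isT hp) _; have [] := output_ge w A S (S' :: h).
move=> hp; have /andP[sSE _] := history_prob_subset hp.
apply: leq_trans (proj1 (output_ge w A S [::])).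
have [[_ maxM] _ _] := validA [::] sSE.
have <- : mu w S = mu w E.
  apply: mu_support => // e eE eS; apply/eqP; rewrite -leqn0 leqNgt; apply/negP => we.
  move: hp; rewrite /= mulr1 /sample_prob sSE (bigD1 e) //= (negPf eS).
  rewrite mulf_eq0 negb_or subr_eq0 => /andP[/eqP p_neq1 _]; apply: p_neq1; apply/esym.
  have W0 : (0 < W)%N by apply: leq_trans we _; rewrite /total_weight (bigD1 e) //= leq_addr.
  rewrite /edge_prob total_importance0 /= mul1r; apply/min_idPl.
  rewrite mulrA ler_pdivlMr ?ltr0n // mul1r.
  rewrite mulrAC ler_pdivlMr //; apply: le_trans smallW _.
  rewrite ler_peMr ?ler1n //.
  by have := rate_ge0 E w eps_gt0; rewrite /rate pmulr_lge0 ?invr_gt0.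
by have [M /maxM leM <-] := mu_attained w S.
Qed.

Lemma card_positive_edges : (#|positive_edges E w| <= W)%N.
Proof.
rewrite -sum1_card /total_weight big_mkcond [X in (_ <= X)%N]big_mkcond /=.
by apply: leq_sum => e _; rewrite inE; case: (e \in E) => //=; case: (w e).
Qed.

(** A large [W * eps] keeps the number of rounds below [W]. With
    [rate * (eps / 2) = 4 * n * ln(n * W)], what remains is [W * n^n * (2nW)^(2n) <= 2^(-n) *
    (nW)^(4n)]. *)
Lemma failure_bound : 8 * n%:R * ln (n%:R * W%:R) < W%:R * eps -> (1 < n)%N ->
  (1 < W)%N /\
  (rounds E w eps)%:R * (#|uncovered_family R E w|%:R * expR (- (rate E w eps * (eps / 2))))
    <= expR (- (ln 2 * n%:R)).
Proof.
move=> bigW n1; have l2 := @ln2_gt R; have l20 : 0 < ln 2 :> R by lra.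
have W0 : (0 < W)%N.
  rewrite lt0n; apply/negP => /eqP W0; move: bigW.
  by rewrite W0 mulr0 ln0 // mulr0 mul0r ltxx.
have nW2 : (2 <= n * W)%N by exact: (leq_mul n1 W0).
have lnnW : ln 2 <= ln (n%:R * W%:R) :> R.
  by rewrite ler_ln ?posrE // -natrM ?ltr0n ?ler_nat // ltnW.
have nR : 2 <= n%:R :> R by rewrite ler_nat.
have WR : 1 <= W%:R :> R by rewrite ler1n.
set L := ln (n%:R * W%:R) in bigW lnnW *.
(* [8 * n * L >= 16 * ln 2 > 8], while [W * eps <= W]. *)
have W8 : (8 <= W)%N.
  rewrite -(ler_nat R); apply: ltW; apply: (@lt_le_trans _ _ (W%:R * eps)); last first.
    by rewrite ler_piMr // ltW.
  by apply: le_lt_trans bigW; nra.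
split; first exact: leq_trans W8.
have lnWL : ln W%:R <= L.
  by rewrite ler_ln ?posrE ?mulr_gt0 ?ltr0n // ?(ltnW n1) // ler_peMl //; lra.
have lW0 : 0 <= ln W%:R :> R by rewrite ln_ge0.
have roundsW : (rounds E w eps <= W)%N.
  have x_ge0 : 0 <= 4 / eps * (ln W%:R / ln 2).
    by apply: mulr_ge0; apply: divr_ge0 => //; exact: ltW.
  rewrite /rounds geq_max W0 /= -lez_nat abszE ger0_norm; last first.
    by rewrite ceil_ge0 (lt_le_trans _ x_ge0) // ltrN10.
  rewrite ceil_le_int -pmulrn.
  rewrite mulrA ler_pdivrMr // mulrAC ler_pdivrMr //.
  have L0 : 0 <= L by lra.
  have le1 : 16 * L <= W%:R * eps by nra.
  have le2 : 16 * L * (2 / 3) <= W%:R * eps * ln 2 by apply: ler_pM => //; lra.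
  by rewrite mulrAC; lra.
have eps_cancel : rate E w eps * (eps / 2) = (4 * n)%:R * L.
  by rewrite /rate -/L natrM; field; rewrite gt_eqF.
rewrite eps_cancel !expRN !expRM_natl expRM_natr !lnK ?posrE ?mulr_gt0 ?ltr0n // ?(ltnW n1) //.
rewrite mulrA -natrM -natrM -!natrX ler_pdivrMr ?ltr0n ?expn_gt0 ?(ltnW nW2) //.
rewrite ler_pdivlMl ?ltr0n ?expn_gt0 // -natrM ler_nat.
have cardF : (#|uncovered_family R E w| <= n ^ n * (2 * (n * W)) ^ (n + n))%N.
  apply: leq_trans (card_uncovered_family R E w) _.
  rewrite leq_mul2l leq_exp2r ?addn_gt0 ?(ltnW n1) //; apply/orP; right.
  apply: (@leq_trans (W * n).+1).
    by rewrite ltnS leq_mul2r card_positive_edges orbT.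
  by rewrite mulnC; clear -nW2; lia.
apply: (@leq_trans (2 ^ n * (W * (n ^ n * (2 * (n * W)) ^ (n + n))))%N).
  by rewrite leq_mul2l leq_mul ?orbT.
(* The factor [8^n] collects [2^n] from the target and [2^(2n)] from the family bound. *)
have key : (W * 8 ^ n <= (W * W) ^ n)%N.
  rewrite expnMn leq_mul ?leq_exp2r ?(ltnW n1) //.
  by rewrite -[X in (X <= _)%N]expn1 leq_exp2l ?(ltnW n1) //; exact: leq_trans W8.
have -> : (2 ^ n * (W * (n ^ n * (2 * (n * W)) ^ (n + n))) =
           (W * 8 ^ n) * (n ^ n * (n * W) ^ (n + n)))%N.
  by rewrite (expnMn 2) -[8%N]/(2 ^ 3)%N -expnM mulSn mul2n -addnn !expnD; ring.
apply: leq_trans (leq_mul key (leqnn _)) _.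
rewrite !mulSn mul0n addn0 !expnD !expnMn.
set a := (n ^ n)%N; set b := (W ^ n)%N.
have a1 : (0 < a)%N by rewrite expn_gt0 (ltnW n1).
have -> : (b * b * (a * (a * b * (a * b))) = a * a * a * b * b * b * b * 1)%N by ring.
have -> : (a * b * (a * b * (a * b * (a * b))) = a * a * a * b * b * b * b * a)%N by ring.
by rewrite leq_mul2l a1 orbT.
Qed.

End Rounds.

Theorem theorem4p1 (R : realType) :
  exists2 c : R, 0 < c &
    forall (V : finType) (E : {set {set V}}) (w : {set V} -> nat) (eps : R)
      (A : solver R V),
      simple_graph E -> 0 < eps -> eps < 1 -> valid_solver E w A ->
      1 - expR (- (c * #|V|%:R)) <=
      output_prob E w eps A
        (fun M => matching E M && ((1 - eps) * (mu w E)%:R <= (weight w M)%:R)).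
Proof.
(* With [c = ln 2] the failure probability is bounded by [2^(-n)]. *)
exists (ln 2); first by rewrite ln_gt0 // ltr1n.
move=> V E w eps A simpleE eps0 eps1 validA.
set good := fun M => _; set k := rounds E w eps.
pose fail := \sum_(h : k.-tuple {set {set V}} | ~~ good (output w A h))
               history_prob E w eps A h.
have -> : output_prob E w eps A good = 1 - fail.
  rewrite -(sum_history_prob E w eps A k).
  rewrite [X in X - _](bigID (fun h : k.-tuple _ => good (output w A h))) /=.
  by rewrite addrK.
rewrite lerD2l lerN2.
have hp_ge0 h := history_prob_ge0 E w A eps0 h.
have k0 : (0 < k)%N by rewrite /k /rounds leq_max.
have [smallW|bigW] := leP ((total_weight E w)%:R * eps)
  (8 * #|V|%:R * ln (#|V|%:R * (total_weight E w)%:R)).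
  rewrite /fail big1 ?expR_ge0 // => h; apply: contraNeq => hp.
  rewrite /good output_matching ?(history_prob_subset hp) //=.
  apply: (@le_trans _ _ (mu w E)%:R); first by rewrite ler_piMl //; lra.
  rewrite ler_nat; apply: (first_round_optimal eps0 validA smallW _ hp).
  by rewrite -size_eq0 size_tuple -lt0n.
(* With at most one vertex there is no edge, so [W = 0] and, as [ln 0 = 0], [bigW] reads [0 < 0]. *)
have n1 : (1 < #|V|)%N.
  rewrite ltnNge; apply/negP => n1; move: bigW.
  rewrite (_ : total_weight E w = 0%N) ?mul0r ?mulr0 ?ln0 ?mulr0 ?ltxx //.
  apply: big1 => e /simpleE e2; exfalso.
  by have := max_card (mem e); rewrite e2 leqNgt ltnS n1.
have [W1 le_fail] := failure_bound eps0 eps1 bigW n1.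
apply: le_trans le_fail.
apply: le_trans (sum_occurs_le eps0 k (fun h => sum_bad_round_le eps0 simpleE validA
   (total_importance_gt0 A h (ltnW W1)))).
rewrite /fail big_mkcond [leRHS]big_mkcond /=; apply: ler_sum => h _.
(* A history of nonzero probability consists of subsets of [E], as [good_output] requires. *)
have [->|hp] := eqVneq (history_prob E w eps A h) 0; first by rewrite !if_same.
case: (boolP (occurs _ _)) => [_|nocc]; first by case: ifP.
rewrite ifF //; apply/negbTE; rewrite negbK /good.
rewrite output_matching ?(history_prob_subset hp) //=.
by apply: good_output; rewrite ?size_tuple ?(history_prob_subset hp).
Qed.
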